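(* Let $a>0$ and let $k$ be a positive integer. Let $\psi(t)=\sum_{n\ge1}e^{-\pi n^2 t/a}$, $\phi(t)=\sum_{n\ge1}e^{-\pi n^2 a t}$, and \[\epsilon_{2k}(a)=\frac{1}{4\pi a}\int_1^\infty \{\psi(t)+a^{1/2}\phi(t)\}\,\frac{(t-1)^{2k}}{(1+t)^{2k+3/2}}\,dt.\] Let $\Psi(\tau)=\sum_{n\ge1}e^{-\pi n^2\tau}$ for $\tau>0$ and $E_{2k}(a)=a^{1/4}\Psi(a)\,U(2k+1,\tfrac12,2\pi a)$. Then \[\epsilon_{2k}(a)<\mathcal{B}_{2k}(a):=\frac{a^{-3/4}(2k)!}{4\sqrt{2}\,\pi}\{E_{2k}(a)+E_{2k}(1/a)\}.\]
   Context: $U(\alpha,b,z)$ denotes the confluent hypergeometric function of the second kind (Tricomi's function), which for $\alpha>0$, $\Re z>0$ has the representation $U(\alpha,b,z)=\frac{1}{\Gamma(\alpha)}\int_0^\infty e^{-zt}t^{\alpha-1}(1+t)^{b-\alpha-1}dt$. *)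

(* Defs.v *)
From HB Require Import structures.
From mathcomp Require Import all_boot all_order all_algebra.
From mathcomp Require Import all_classical all_reals all_analysis.
Set Implicit Arguments. Unset Strict Implicit. Unset Printing Implicit Defensive.
Import Order.TTheory GRing.Theory Num.Theory.
Import numFieldNormedType.Exports.
Local Open Scope classical_set_scope.
Local Open Scope ring_scope.

Section Defs.
Variable R : realType.
Notation mu := (@lebesgue_measure R).

(* Euler Gamma function: Gamma(al) = int_0^oo e^{-t} t^{al-1} dt (finite for al > 0). *)
Definition Gamma (al : R) : R :=
  fine (\int[mu]_(t in `]0%R, +oo[) (expR (- t) * t `^ (al - 1))%:E)%E.

(* Tricomi's function U(al,b,z) via its integral representation (al > 0, z > 0). *)
Definition TricomiU (al b z : R) : R :=
  (Gamma al)^-1 *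
  fine (\int[mu]_(t in `]0%R, +oo[)
          (expR (- (z * t)) * t `^ (al - 1) * (1 + t) `^ (b - al - 1))%:E)%E.

Definition Psi (tau : R) : R :=
  (\big[+%R/0%R]_(1 <= n <oo) expR (- (pi * (n%:R) ^+ 2 * tau)))%BIG.

Definition psi_a (a t : R) : R := (\big[+%R/0%R]_(1 <= n <oo) expR (- (pi * (n%:R) ^+ 2 * t / a)))%BIG.
Definition phi_a (a t : R) : R := (\big[+%R/0%R]_(1 <= n <oo) expR (- (pi * (n%:R) ^+ 2 * a * t)))%BIG.

(* epsilon_{2k}(a), as an extended real (the integrand is nonnegative). *)
Definition epsilon2k (k : nat) (a : R) : \bar R :=
  ((4 * pi * a)^-1)%:E *
  (\int[mu]_(t in `[1%R, +oo[)
     ((psi_a a t + a `^ (1/2) * phi_a a t) *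
      ((t - 1) ^+ (2 * k) / (1 + t) `^ ((2 * k)%:R + 3/2)))%:E)%E.

Definition E2k (k : nat) (a : R) : R :=
  a `^ (1/4) * Psi a * TricomiU ((2 * k)%:R + 1) (1/2) (2 * pi * a).

Definition B2k (k : nat) (a : R) : R :=
  a `^ (- (3/4)) * ((2 * k)`!)%:R / (4 * Num.sqrt 2 * pi) * (E2k k a + E2k k a^-1).

End Defs.

(* Main.v *)
(** With [Psi] the theta sum, [psi t = Psi (t / a)] and [phi t = Psi (a t)].
Since [n ^ 2 >= 1], termwise comparison gives
[Psi (c t) <= Psi c * exp (- pi c (t - 1))] for [t >= 1], strictly for [t > 1]
because of the term [n = 2]; this replaces the term-by-term integration of the
theta series.  Integrating against [(t - 1) ^ 2k / (1 + t) ^ (2k + 3 / 2)] and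
substituting [t = 1 + 2 s] turns the right-hand side into Tricomi's integral
for [(2k)! * U(2k + 1, 1 / 2, 2 pi c)], up to the factor [1 / sqrt 2]; take
[c = 1 / a] and [c = a]. *)
Require Import Defs.
From HB Require Import structures.
From mathcomp Require Import all_boot all_order all_algebra.
From mathcomp Require Import all_classical all_reals all_analysis.
From mathcomp Require Import measurable_realfun ring.
Import Order.TTheory GRing.Theory Num.Theory.
Import numFieldNormedType.Exports.
Local Open Scope classical_set_scope.
Local Open Scope ring_scope.

(** * Strict monotonicity of the integral *)

(** Otherwise the nonnegative function [g - f] would have integral zero and so vanish almost
    everywhere on [D], although it is positive at every point of a set of positive measure. *)
Lemma ge0_lt_integral d (T : measurableType d) (R : realType)
    (mu : {measure set T -> \bar R}) (D : set T) (f g : T -> R) :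
  measurable D -> (0 < mu D)%E -> measurable_fun D f -> measurable_fun D g ->
  (forall x, D x -> 0 <= f x < g x) ->
  (\int[mu]_(x in D) (g x)%:E < +oo)%E ->
  (\int[mu]_(x in D) (f x)%:E < \int[mu]_(x in D) (g x)%:E)%E.
Proof.
move=> mD muD mf mg fg goo.
have mgf : measurable_fun D (g \- f) by exact: measurable_funB.
have gE : (\int[mu]_(x in D) (g x)%:E =
    \int[mu]_(x in D) (f x)%:E + \int[mu]_(x in D) ((g \- f) x)%:E)%E.
  rewrite -ge0_integralD//.
  - by apply: eq_integral => x _; rewrite -EFinD /= addrC subrK.
  - by move=> x /fg/andP[f0 _]; rewrite lee_fin.
  - exact/measurable_EFinP.
  - by move=> x /fg/andP[_ fgx]; rewrite lee_fin subr_ge0 ltW.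
  - exact/measurable_EFinP.
have f0 : (0 <= \int[mu]_(x in D) (f x)%:E)%E.
  by apply: integral_ge0 => x /fg/andP[fx0 _]; rewrite lee_fin.
have h0 : (0 <= \int[mu]_(x in D) ((g \- f) x)%:E)%E.
  by apply: integral_ge0 => x /fg/andP[_ fgx]; rewrite lee_fin subr_ge0 ltW.
(* The integral of [f] is finite, being at most that of [g], so it cancels; what remains is that the
   integral of [g - f] is positive. *)
rewrite gE lteDl; last first.
  rewrite ge0_fin_numE//; apply: le_lt_trans goo; rewrite gE leeDl//.
rewrite lt_neqAle h0 andbT eq_sym; apply/eqP => h.
have : (\int[mu]_(x in D) `|((g \- f) x)%:E| = 0)%E.
  rewrite -[RHS]h; apply: eq_integral => x; rewrite inE => /fg/andP[_ fgx].
  by rewrite gee0_abs// lee_fin subr_ge0 ltW.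
move/(ae_eq_integral_abs mu mD); case; first exact/measurable_EFinP.
move=> N [mN muN DN].
(* The null set [N] contains all points of [D] where [g - f] is nonzero, hence all of [D]. *)
move: muD; rewrite ltNge => /negP; apply.
rewrite -muN; apply: le_measure; rewrite ?inE// => x Dx; apply: DN => /= /(_ Dx).
have /andP[_ fgx] := fg _ Dx.
by move=> [] /eqP; rewrite subr_eq0 gt_eqF.
Qed.

(** * The Gamma function at positive integers *)

Section Gamma.
Context {R : realType}.
Notation mu := (@lebesgue_measure R).

(** One Taylor term of the exponential, [x ^ (n+1) / (n+1)! <= exp x], bounds the function by
    [(n+1)! / x] for [x > 0]. *)
Lemma cvgy_expRN_exprn n : expR (- x) * x ^+ n @[x --> (+oo : set_system R)] --> (0 : R).
Proof.
apply: (@squeeze_cvgr _ _ _ _ (cst 0) (fun x => n.+1`!%:R * x^-1)).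
- near=> x; have x0 : 0 < x by near: x; exact: nbhs_pinfty_gt.
  rewrite /cst mulr_ge0 ?expR_ge0 ?exprn_ge0 ?(ltW x0)//= expRN.
  rewrite [leLHS]mulrC ler_pdivrMr ?expR_gt0//.
  have fp : 0 < n.+1`!%:R :> R by rewrite ltr0n fact_gt0.
  have := expR_ge1Dxn n (ltW x0).
  rewrite exprS => h.
  have {}h : x * x ^+ n / n.+1`!%:R <= expR x by apply: le_trans h; rewrite lerDr.
  by rewrite mulrAC ler_pdivlMr// mulrC [_ * expR x]mulrC -ler_pdivrMr.
- exact: cvg_cst.
- rewrite -[X in _ --> X](mulr0 n.+1`!%:R); apply: cvgMr.
  apply/gtr0_cvgV0; last exact: cvg_id.
  exact: nbhs_pinfty_gt.
Unshelve. all: by end_near. Qed.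

(** Closed-form antiderivative of [exp (-x) * x ^ n / n!]: minus the normalised upper incomplete
    Gamma function at [n + 1]. *)
Let F n (x : R) : R := - (expR (- x) * \sum_(j < n.+1) x ^+ j / j`!%:R).

Let F_S n x : F n.+1 x = F n x - expR (- x) * x ^+ n.+1 / n.+1`!%:R.
Proof. by rewrite /F big_ord_recr/= mulrDr opprD !mulrA. Qed.

Let F0 n : F n 0 = - 1.
Proof.
rewrite /F oppr0 expR0 mul1r big_ord_recl expr0 fact0 divr1 big1 ?addr0// => i _.
by rewrite expr0n mul0r.
Qed.

(** The sum telescopes: by the product rule, the term added at [n + 1] contributes the new integrand
    and cancels the old one. *)
Let is_derive_F n (x : R) : is_derive x 1 (F n) (expR (- x) * x ^+ n / n`!%:R).
Proof.
elim: n => [|n IH].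
  rewrite /F; under eq_fun do rewrite big_ord1 expr0 fact0 divr1 mulr1.
  by apply: is_derive_eq; rewrite expr0 fact0 divr1 !mulr1 mulrN1 opprK.
have dE : is_derive x 1 (fun y : R => expR (- y)) (- expR (- x)).
  by apply: is_derive_eq; rewrite mulrN1.
have dX : is_derive x 1 (fun y : R => y ^+ n.+1) (n.+1%:R * x ^+ n).
  apply: DeriveDef; first exact: exprn_derivable.
  by rewrite exp_derive /GRing.scale/= mulr1.
rewrite (_ : F n.+1 = F n - n.+1`!%:R^-1 *: ((fun y : R => expR (- y)) * (fun y => y ^+ n.+1))).
  apply: is_derive_eq.
  rewrite /GRing.scale/= factS natrM.
  have fn0 : n`!%:R != 0 :> R by rewrite pnatr_eq0 -lt0n fact_gt0.
  by rewrite exprS; field; rewrite fn0 ?nat1r ?natr1 ?pnatr_eq0.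
by apply/funext => y; rewrite F_S /= !fctE /GRing.scale/= [_^-1 * _]mulrC.
Qed.

Let cvgy_F n : F n x @[x --> (+oo : set_system R)] --> (0 : R).
Proof.
elim: n => [|n IH].
  rewrite /F; under eq_fun do rewrite big_ord1 expr0 fact0 divr1 mulr1.
  by rewrite -oppr0; apply: cvgN; exact: cvgr_expR.
rewrite (_ : F n.+1 = fun x => F n x - expR (- x) * x ^+ n.+1 / n.+1`!%:R); last first.
  by apply/funext => x; rewrite F_S.
have := cvgB IH (cvgM (cvgy_expRN_exprn n.+1) (cvg_cst (n.+1`!%:R^-1 : R))).
by rewrite mul0r subr0; apply.
Qed.

(** After division by [n!], the integral is the limit of [F n] at infinity minus [F n 0], that is
    [0 - (-1) = 1]. *)
Lemma Gamma_fact n : Gamma (n%:R + 1) = n`!%:R :> R.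
Proof.
have fp : 0 < n`!%:R :> R by rewrite ltr0n fact_gt0.
have cF (x : R) : {for x, continuous (F n)}.
  by apply: differentiable_continuous; apply/derivable1_diffP; case: (is_derive_F n x).
have cf : continuous (fun x : R => expR (- x) * x ^+ n / n`!%:R).
  move=> x; apply: cvgMr_tmp; apply: cvgM; last exact: exprn_continuous.
  by apply: (@continuous_comp _ _ _ -%R expR); [exact: opp_continuous|exact: continuous_expR].
have mf := continuous_measurable_fun cf.
rewrite /Gamma integral_itv_obnd_cbnd; last first.
  apply/measurable_EFinP; apply: measurable_funTS; apply: measurable_funM => //.
    by apply: measurableT_comp => //; exact: measurable_funN.
transitivity (fine (\int[mu]_(x in `[0%R, +oo[) (n`!%:R%:E * (expR (- x) * x ^+ n / n`!%:R)%:E))%E).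
  congr fine; apply: eq_integral => x; rewrite inE/= in_itv/= andbT => x0.
  by rewrite addrK powR_mulrn// -EFinM [in RHS]mulrC divfK// gt_eqF.
rewrite ge0_integralZl_EFin//; last 2 first.
- move=> x; rewrite /= in_itv/= andbT => x0.
  by rewrite lee_fin divr_ge0 ?mulr_ge0 ?expR_ge0 ?exprn_ge0.
- by apply/measurable_EFinP; exact: measurable_funTS.
rewrite (@ge0_continuous_FTC2y _ _ (F n) _ 0)//.
- by rewrite F0 EFinN oppeK add0e mule1.
- by move=> x x0; rewrite divr_ge0 ?mulr_ge0 ?expR_ge0 ?exprn_ge0.
- exact: continuous_subspaceT.
- by move=> x _; case: (is_derive_F n x).
- exact: (cvg_at_right_filter (cF 0)).
- by move=> x _; rewrite derive1E; case: (is_derive_F n x).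
Qed.
End Gamma.

(** * The theta sum: convergence, strict decay, measurability *)

Section Psi.
Context {R : realType}.
Implicit Types t tau : R.

Let term tau n : R := expR (- (pi * n%:R ^+ 2 * tau)).

(** Since [n ^ 2 >= n], with equality at [n = 0], the geometric bound holds from index 0 on. *)
Let ler_term tau n : 0 < tau -> term tau n <= geometric 1 (expR (- (pi * tau))) n.
Proof.
move=> tau0; rewrite /term /= mul1r -expRM_natl ler_expR mulrN lerN2 mulrCA mulrA.
rewrite ler_pM2r// ler_pM2l ?pi_gt0// expr2.
by case: n => [|n]; rewrite ?mulr0// ler_peMl// ler1n.
Qed.

Lemma is_cvg_Psi tau : 0 < tau ->
  cvgn (fun n => \sum_(1 <= i < n) expR (- (pi * i%:R ^+ 2 * tau))).
Proof.
move=> tau0; rewrite (is_cvg_series_restrict 1 (term tau)).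
apply: (@series_le_cvg _ (term tau) (geometric 1 (expR (- (pi * tau))))).
- by move=> n; exact: expR_ge0.
- by move=> n; rewrite /= mul1r exprn_ge0 ?expR_ge0.
- by move=> n; exact: ler_term.
- apply: is_cvg_geometric_series.
  by rewrite ger0_norm ?expR_ge0// expR_lt1 oppr_lt0 mulr_gt0 ?pi_gt0.
Qed.

Lemma Psi_ge0 tau : 0 < tau -> 0 <= Psi tau.
Proof.
move=> tau0; apply: limr_ge; first exact: is_cvg_Psi.
by apply: nearW => n; apply: sumr_ge0 => i _; exact: expR_ge0.
Qed.

(** The exponents of the two [n]-th terms differ by [(n ^ 2 - 1) * pi * tau * (t - 1)], nonnegative
    for [n >= 1] and positive for [n = 2]. A limit preserves only weak inequalities, so the gap at
    [n = 2] serves as a fixed positive lower bound for the differences of partial sums. *)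
Lemma Psi_lt tau t : 0 < tau -> 1 < t ->
  Psi (tau * t) < Psi tau * expR (- (pi * tau * (t - 1))).
Proof.
move=> tau0 t1; set q := expR _.
have taut : 0 < tau * t by rewrite mulr_gt0// (lt_trans _ t1).
have d0 : 0 < pi * tau * (t - 1) by rewrite !mulr_gt0 ?pi_gt0 ?subr_gt0.
(* Here [y] stands for the square of the summation index. *)
have dE (y : R) : - (pi * y * tau) - pi * tau * (t - 1) - - (pi * y * (tau * t)) =
    (y - 1) * (pi * tau * (t - 1)) by ring.
have le_q i : (0 < i)%N -> term (tau * t) i <= term tau i * q.
  move=> i0; rewrite /term -expRD ler_expR -subr_ge0 dE mulr_ge0// ?(ltW d0)//.
  by rewrite subr_ge0 exprn_ege1// ler1n.
have lt_q : term (tau * t) 2 < term tau 2 * q.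
  rewrite /term -expRD ltr_expR -subr_gt0 dE mulr_gt0//.
  by rewrite subr_gt0 -natrX ltr1n.
rewrite -subr_gt0; apply: (lt_le_trans (y := term tau 2 * q - term (tau * t) 2)).
  by rewrite subr_gt0.
have cB : \sum_(1 <= i < n) term tau i * q - \sum_(1 <= i < n) term (tau * t) i @[n --> \oo]
    --> Psi tau * q - Psi (tau * t).
  under eq_fun do rewrite -mulr_suml.
  by apply: cvgB; [apply: cvgMr_tmp|]; exact: is_cvg_Psi.
rewrite -(cvg_lim _ cB)//; apply: limr_ge; first by apply/cvg_ex; eexists; exact: cB.
near=> n.
rewrite -sumrB.
(* Splitting at 3 isolates the indices 1 and 2; index 2 gives the gap, all other differences are
   nonnegative. *)
rewrite (big_cat_nat _ (n := 3))//=; last by near: n; exact: nbhs_infty_ge.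
rewrite 2?big_nat_recr//= big_geq// add0r -addrA addrCA lerDl addr_ge0//.
  by rewrite subr_ge0 le_q.
rewrite big_nat_cond; apply: sumr_ge0 => i; rewrite andbT => /andP[i3 _].
by rewrite subr_ge0 le_q// (leq_trans _ i3).
Unshelve. all: by end_near. Qed.

Lemma measurable_Psi (c : R) : 0 < c ->
  measurable_fun (`]1%R, +oo[ : set R) (fun t : R => Psi (c * t)).
Proof.
move=> c0; apply: (@measurable_fun_cvg _ _ _ _ (fun n t => \sum_(1 <= i < n) term (c * t) i)).
  move=> n; apply: measurable_sum => i; apply: measurable_funTS.
  apply: measurableT_comp => //; apply: measurable_funN; apply: measurable_funM => //.
move=> t; rewrite /= in_itv/= andbT => t1; apply: is_cvg_Psi.
by rewrite mulr_gt0// (lt_trans _ t1).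
Qed.
End Psi.

(** * Tricomi's integral and the substitution leading to it *)

Section Tricomi.
Context {R : realType}.
Notation mu := (@lebesgue_measure R).
Implicit Types n : nat.

Definition epsilon_weight n (t : R) : R := (t - 1) ^+ n / (1 + t) `^ (n%:R + 3 / 2).

(** The integrand of [TricomiU] at [al = n + 1] and [b = 1 / 2], with exponents left unsimplified so
    that it matches that definition literally. *)
Definition Tricomi_integrand n (z t : R) : R :=
  expR (- (z * t)) * t `^ (n%:R + 1 - 1) * (1 + t) `^ (1 / 2 - (n%:R + 1) - 1).

Lemma measurable_epsilon_weight n : measurable_fun setT (epsilon_weight n).
Proof.
rewrite /epsilon_weight.
apply: measurable_funM.
  by apply: measurable_funX; exact: measurable_funB.
rewrite (_ : (fun x => ((1 + x) `^ (n%:R + 3 / 2))^-1) =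
             (@powR R)^~ (- (n%:R + 3 / 2)) \o (fun x => 1 + x)).
  by apply: measurableT_comp; [exact: measurable_powR|exact: measurable_funD].
by apply/funext => x; rewrite /= powRN.
Qed.

Lemma measurable_Tricomi_integrand n z : measurable_fun setT (Tricomi_integrand n z).
Proof.
rewrite /Tricomi_integrand.
apply: measurable_funM; last first.
  by apply: (measurableT_comp (measurable_powR _)); exact: measurable_funD.
apply: measurable_funM; last exact: measurable_powR.
by apply: measurableT_comp => //; apply: measurable_funN; exact: measurable_funM.
Qed.

Lemma Tricomi_integrand_ge0 n z t : 0 <= Tricomi_integrand n z t.
Proof. by rewrite !mulr_ge0 ?expR_ge0 ?powR_ge0. Qed.

(** The algebraic factor is [t ^ n / (1 + t) ^ (n + 3 / 2)], at most 1 because [t <= 1 + t] and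
    [1 <= 1 + t]. *)
Lemma Tricomi_integrand_le n z (t : R) : 0 <= t -> Tricomi_integrand n z t <= expR (- (z * t)).
Proof.
move=> t0; rewrite /Tricomi_integrand -mulrA ler_piMr ?expR_ge0//.
rewrite addrK (_ : 1 / 2 - _ - 1 = - (n%:R + 3 / 2)); last by field.
have t1 : 1 <= 1 + t by rewrite lerDl.
rewrite powRN ler_pdivrMr ?mul1r ?powR_gt0 ?(lt_le_trans _ t1)//.
apply: (@le_trans _ _ ((1 + t) `^ n%:R)).
  by rewrite ge0_ler_powR ?nnegrE// ?lerDr// (le_trans _ t1).
by rewrite ler_powR// lerDl.
Qed.

(** The dominating function [exp (- z t)] is [1 / z] times the exponential density of rate [z],
    which has total mass 1. *)
Lemma integral_Tricomi_integrand_lty n (z : R) : 0 < z ->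
  (\int[mu]_(t in `]0%R, +oo[) (Tricomi_integrand n z t)%:E < +oo)%E.
Proof.
move=> z0; have mpdf := measurable_exponential_pdf z.
have pdf0 t : 0 <= exponential_pdf z t by apply: exponential_pdf_ge0; exact: ltW.
apply: (@le_lt_trans _ _ (\int[mu]_(t in `]0%R, +oo[) (z^-1%:E * (exponential_pdf z t)%:E))%E).
  apply: ge0_le_integral => //.
  - by move=> t _; rewrite lee_fin Tricomi_integrand_ge0.
  - by apply/measurable_EFinP; apply: measurable_funTS; exact: measurable_Tricomi_integrand.
  - by apply/measurable_EFinP; apply: measurable_funTS; exact: measurable_funM.
  - move=> t /=; rewrite in_itv/= andbT => t0.
    rewrite -EFinM lee_fin; apply: le_trans (Tricomi_integrand_le _ _ _ (ltW t0)) _.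
    by rewrite (exponential_pdfE _ (ltW t0)) mulKf ?gt_eqF// mulNr.
rewrite ge0_integralZl_EFin//.
- rewrite lte_mul_pinfty ?lee_fin ?invr_ge0 ?ltW//.
  apply: (@le_lt_trans _ _ (\int[mu]_t (exponential_pdf z t)%:E)%E).
    by apply: ge0_subset_integral => //; [exact/measurable_EFinP|move=> t _; rewrite lee_fin].
  by rewrite integral_exponential_pdf// ltry.
- by move=> t _; rewrite lee_fin.
- by apply/measurable_EFinP; exact: measurable_funTS.
- by rewrite invr_ge0 ltW.
Qed.

Lemma continuous_expR_epsilon_weight n (z t : R) : 0 < 1 + t ->
  {for t, continuous (fun s : R => expR (- (z * (s - 1))) * epsilon_weight n s)}.
Proof.
move=> t0.
have cexp : {for t, continuous (fun s : R => expR (- (z * (s - 1))))}.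
  apply: (@continuous_comp R R R (fun s => - (z * (s - 1))) expR); last exact: continuous_expR.
  by apply: cvgN; apply: cvgMl_tmp; apply: cvgB => //; exact: cvg_cst.
have cpol : {for t, continuous (fun s : R => (s - 1) ^+ n)}.
  apply: (@continuous_comp R R R (fun s => s - 1) (fun s => s ^+ n)); last exact: exprn_continuous.
  by apply: cvgB => //; exact: cvg_cst.
have cpow : {for t, continuous (fun s : R => (1 + s) `^ (n%:R + 3 / 2))}.
  apply: (@continuous_comp R R R (fun s => 1 + s) (fun s => s `^ (n%:R + 3 / 2))).
    by apply: cvgD => //; exact: cvg_cst.
  apply: differentiable_continuous; apply/derivable1_diffP.
  by apply: derivable_powR; rewrite in_itv/= t0.
by apply: cvgM => //; apply: cvgM => //; apply: cvgV => //; rewrite gt_eqF ?powR_gt0.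
Qed.

(** Under [t = 1 + 2 s] one has [t - 1 = 2 s], [1 + t = 2 (1 + s)] and [dt = 2 ds]; the powers of 2
    collect to [2 ^ n * 2 / 2 ^ (n + 3 / 2) = 1 / sqrt 2]. *)
Lemma integral_epsilon_weight n (z : R) :
  (\int[mu]_(t in `[1%R, +oo[) (expR (- (z * (t - 1))) * epsilon_weight n t)%:E
  = (Num.sqrt 2)^-1%:E * \int[mu]_(t in `]0%R, +oo[) (Tricomi_integrand n (2 * z) t)%:E)%E.
Proof.
have s2 : 0 < Num.sqrt 2 :> R by rewrite sqrtr_gt0.
pose F (s : R) : R := 2 * s + 1.
have F0 : F 0 = 1 by rewrite /F mulr0 add0r.
have dF (s : R) : is_derive s 1 F 2.
  rewrite /F; apply: is_derive_eq; rewrite addr0; exact: mulr1.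
have dFE : derive1 F = cst 2.
  by apply/funext => s; rewrite derive1E derive_val.
have cF (s : R) : {for s, continuous F}.
  by apply: differentiable_continuous; apply/derivable1_diffP; case: (dF s).
pose G (t : R) : R := expR (- (z * (t - 1))) * epsilon_weight n t.
transitivity (\int[mu]_(t in `[F 0%R, +oo[) (G t)%:E)%E; first by rewrite F0.
rewrite (@increasing_ge0_integration_by_substitutiony _ F _ 0); last first.
- rewrite F0 => t; rewrite in_itv/= andbT => t1; rewrite /G /epsilon_weight.
  by rewrite mulr_ge0 ?expR_ge0// divr_ge0 ?powR_ge0// exprn_ge0// subr_ge0 ltW.
- apply: continuous_in_subspaceT => t; rewrite F0 inE/= in_itv/= andbT => t1.
  have t0 : 0 < 1 + t by rewrite addr_gt0// (lt_le_trans _ t1).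
  exact: continuous_expR_epsilon_weight.
- have Fle : \forall s \near (+oo : set_system R), id s <= F s.
    exists 0; split => // s s0.
    by rewrite /F /= mulr_natl mulr2n -addrA lerDl addr_ge0// ltW.
  by apply: ger_cvgy Fle _; exact: cvg_id.
- split; last exact: (cvg_at_right_filter (cF 0)).
  by move=> s _; case: (dF s).
- by rewrite dFE; exact: is_cvg_cst.
- by rewrite dFE; exact: is_cvg_cst.
- by move=> s _; rewrite dFE; exact: cvg_cst.
- by move=> s t _ _ st; rewrite /F ltrD2r ltr_pM2l.
rewrite integral_itv_obnd_cbnd; last first.
  by apply/measurable_EFinP; apply: measurable_funTS; exact: measurable_Tricomi_integrand.
rewrite -ge0_integralZl_EFin//; last 2 first.
- by move=> t _; rewrite lee_fin Tricomi_integrand_ge0.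
- by apply/measurable_EFinP; apply: measurable_funTS; exact: measurable_Tricomi_integrand.
apply: eq_integral => t; rewrite inE/= in_itv/= andbT => t0; rewrite -EFinM; congr EFin.
have t1 : 0 < 1 + t by rewrite ltr_pwDl.
rewrite dFE /G /F /epsilon_weight /Tricomi_integrand /= !fctE /= !addrK.
rewrite (_ : 1 / 2 - _ - 1 = - (n%:R + 3 / 2)); last by field.
rewrite powRN powR_mulrn// (_ : 1 + (2 * t + 1) = 2 * (1 + t)); last by ring.
rewrite powRM// ?(ltW t1)// exprMn.
(* The factors [2 ^ n] and 2 cancel against the numerator and the Jacobian. *)
have -> : 2 `^ (n%:R + 3 / 2) = 2 ^+ n * 2 * Num.sqrt 2 :> R.
  rewrite -powR12_sqrt// -powR_mulrn// -[X in _ * X * _]powRr1// -!powRD ?pnatr_eq0 ?implybT//.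
  by congr powR; field.
have p0 : (1 + t) `^ (n%:R + 3 / 2) != 0 by rewrite gt_eqF ?powR_gt0.
have e0 : (2 : R) ^+ n != 0 by rewrite expf_neq0.
rewrite (_ : z * (2 * t) = 2 * z * t); last by ring.
by field; rewrite p0 e0 gt_eqF.
Qed.
End Tricomi.

(** * Strict bound for one weighted theta integral *)

Section EpsilonIntegral.
Context {R : realType}.
Notation mu := (@lebesgue_measure R).
Implicit Types (n : nat) (c z : R).

Lemma epsilon_weight_gt0 n (t : R) : 1 < t -> 0 < epsilon_weight n t.
Proof.
move=> t1; rewrite divr_gt0 ?exprn_gt0 ?powR_gt0 ?subr_gt0//.
by rewrite addr_gt0// (lt_trans _ t1).
Qed.

(** The factor [n!] cancels the [1 / Gamma (n + 1)] in [TricomiU]. Finiteness is essential: [fine]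
    would send an infinite integral to 0. *)
Lemma integral_Tricomi_integrandE n z : 0 < z ->
  (\int[mu]_(t in `]0%R, +oo[) (Tricomi_integrand n z t)%:E =
   (n`!%:R * TricomiU (n%:R + 1) (1 / 2) z)%:E)%E.
Proof.
move=> z0; rewrite /TricomiU Gamma_fact mulVKf ?pnatr_eq0 -?lt0n ?fact_gt0//.
rewrite fineK// ge0_fin_numE ?integral_Tricomi_integrand_lty//.
by apply: integral_ge0 => t _; rewrite lee_fin Tricomi_integrand_ge0.
Qed.

(** [Psi_lt] bounds the integrand pointwise by [Psi c * g t], whose integral is evaluated by the
    substitution with [z = pi * c]. *)
Lemma integral_Psi_epsilon_weight_lt n c : 0 < c ->
  (\int[mu]_(t in `[1%R, +oo[) (Psi (c * t) * epsilon_weight n t)%:E <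
   (Psi c * ((Num.sqrt 2)^-1 * (n`!%:R * TricomiU (n%:R + 1) (1 / 2) (2 * pi * c))))%:E)%E.
Proof.
move=> c0.
have pc0 : 0 < pi * c by rewrite mulr_gt0 ?pi_gt0.
pose g (t : R) : R := expR (- (pi * c * (t - 1))) * epsilon_weight n t.
have mg : measurable_fun setT g.
  apply: measurable_funM; last exact: measurable_epsilon_weight.
  apply: measurableT_comp => //; apply: measurable_funN; apply: measurable_funM => //.
  exact: measurable_funB.
have gE : (\int[mu]_(t in `[1%R, +oo[) (Psi c * g t)%:E =
    (Psi c * ((Num.sqrt 2)^-1 * (n`!%:R * TricomiU (n%:R + 1) (1 / 2) (2 * pi * c))))%:E)%E.
  transitivity (\int[mu]_(t in `[1%R, +oo[) ((Psi c)%:E * (g t)%:E))%E.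
    by apply: eq_integral => t _; rewrite EFinM.
  rewrite ge0_integralZl_EFin//; last 3 first.
  - move=> t; rewrite /= in_itv/= andbT le_eqVlt => /predU1P[<-|t1].
      by rewrite lee_fin /g /epsilon_weight subrr mulr_ge0 ?expR_ge0// divr_ge0 ?powR_ge0// exprn_ge0.
    by rewrite lee_fin mulr_ge0 ?expR_ge0// (ltW (epsilon_weight_gt0 _ _ t1)).
  - by apply/measurable_EFinP; exact: measurable_funTS.
  - exact: Psi_ge0.
  rewrite integral_epsilon_weight integral_Tricomi_integrandE ?mulr_gt0 ?pi_gt0//.
  by rewrite mulrA -!EFinM.
have mPsi : measurable_fun (`]1%R, +oo[ : set R) (fun t : R => Psi (c * t) * epsilon_weight n t).
  apply: measurable_funM; first exact: measurable_Psi.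
  by apply: measurable_funTS; exact: measurable_epsilon_weight.
have mPg : measurable_fun (`]1%R, +oo[ : set R) (fun t : R => Psi c * g t).
  by apply: measurable_funM => //; exact: measurable_funTS.
(* The endpoint 1 is removed because the two integrands coincide there, while the comparison of
   integrals asks for strictness at every point. *)
rewrite -gE -!integral_itv_obnd_cbnd; [|exact/measurable_EFinP|exact/measurable_EFinP].
apply: ge0_lt_integral => //.
- by rewrite [X in (_ < X)%E](lebesgue_measure_itv `]1%R, +oo[)/= ltry addye ?ltry//.
- move=> t; rewrite /= in_itv/= andbT => t1.
  have w0 := epsilon_weight_gt0 n t t1.
  rewrite mulr_ge0 ?(ltW w0) ?Psi_ge0 ?mulr_gt0 ?(lt_trans _ t1)//=.
  by rewrite /g mulrA ltr_pM2r// Psi_lt.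
- by rewrite integral_itv_obnd_cbnd ?gE ?ltry//; exact/measurable_EFinP.
Qed.
End EpsilonIntegral.

(** * Assembly of the two bounds, for [c = 1 / a] and [c = a] *)

Theorem theorem3 (R : realType) (a : R) (k : nat) :
  0 < a -> (0 < k)%N -> (epsilon2k k a < (B2k k a)%:E)%E.
Proof.
move=> a0 _.
have V0 : 0 < a^-1 by rewrite invr_gt0.
set n := (2 * k)%N.
pose I (c : R) := (\int[@lebesgue_measure R]_(t in `[1%R, +oo[) (Psi (c * t) * epsilon_weight n t)%:E)%E.
have psiE t : psi_a a t = Psi (a^-1 * t).
  rewrite /psi_a /Psi; congr (limn _); apply/funext => m; apply: eq_bigr => i _.
  by rewrite [a^-1 * t]mulrC; congr (expR (- _)); rewrite [RHS]mulrA.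
have phiE t : phi_a a t = Psi (a * t).
  rewrite /phi_a /Psi; congr (limn _); apply/funext => m; apply: eq_bigr => i _.
  by congr (expR (- _)); rewrite [RHS]mulrA.
have integrandE t : (psi_a a t + a `^ (1 / 2) * phi_a a t) *
      ((t - 1) ^+ (2 * k) / (1 + t) `^ ((2 * k)%:R + 3 / 2)) =
    Psi (a^-1 * t) * epsilon_weight n t + a `^ (1 / 2) * (Psi (a * t) * epsilon_weight n t).
  by rewrite psiE phiE [LHS]mulrDl -[X in _ + X = _]mulrA.
have mI (c : R) : 0 < c -> measurable_fun (`]1%R, +oo[ : set R) (fun t : R => Psi (c * t) * epsilon_weight n t).
  move=> c0; apply: measurable_funM; first exact: measurable_Psi.
  by apply: measurable_funTS; exact: measurable_epsilon_weight.
have I0 (c t : R) : 0 < c -> (`]1%R, +oo[%classic : set R) t -> 0 <= Psi (c * t) * epsilon_weight n t.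
  move=> c0; rewrite /= in_itv/= andbT => t1.
  by rewrite mulr_ge0 ?Psi_ge0 ?mulr_gt0 ?(lt_trans _ t1)// (ltW (epsilon_weight_gt0 _ _ t1)).
have epsE : epsilon2k k a = (((4 * pi * a)^-1)%:E * (I a^-1%R + (a `^ (1 / 2))%:E * I a))%E.
  rewrite /epsilon2k /I; congr (_ * _)%E.
  (* Linearity is applied on the open half-line, where measurability of the theta sums has been
     established. *)
  rewrite -!integral_itv_obnd_cbnd; last 3 first.
  - by apply/measurable_EFinP; exact: mI.
  - by apply/measurable_EFinP; exact: mI.
  - apply/measurable_EFinP.
    rewrite (_ : (fun t => _) = (fun t => Psi (a^-1 * t) * epsilon_weight n t) \+
                  (fun t => a `^ (1 / 2) * (Psi (a * t) * epsilon_weight n t))).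
      by apply: measurable_funD; [|apply: measurable_funM => //]; exact: mI.
    by apply/funext => t; rewrite integrandE.
  rewrite -ge0_integralZl_EFin ?powR_ge0//; last 2 first.
  - by move=> t /(I0 _ _ a0); rewrite lee_fin.
  - by apply/measurable_EFinP; exact: mI.
  rewrite -ge0_integralD//.
  - by apply: eq_integral => t _; rewrite -EFinM -EFinD integrandE.
  - by move=> t /(I0 _ _ V0); rewrite lee_fin.
  - by apply/measurable_EFinP; exact: mI.
  - by move=> t /(I0 _ _ a0) It; rewrite mule_ge0// lee_fin powR_ge0.
  - apply/measurable_EFinP; apply: measurable_funM => //; exact: mI.
have := integral_Psi_epsilon_weight_lt n _ V0.
have := integral_Psi_epsilon_weight_lt n _ a0.
rewrite -!/(I _) epsE => h1 h2.
(* Both integrals are replaced by their strict bounds; all the strictness is gained here, and the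
   intermediate value will equal [B2k k a]. *)
apply: (@lt_le_trans _ _ (((4 * pi * a)^-1)%:E *
 ((Psi a^-1 * ((Num.sqrt 2)^-1 * (n`!%:R * TricomiU (n%:R + 1) (1 / 2) (2 * pi * a^-1))))%:E + (a `^ (1 / 2))%:E * (Psi a * ((Num.sqrt 2)^-1 * (n`!%:R * TricomiU (n%:R + 1) (1 / 2) (2 * pi * a))))%:E))%E).
  rewrite lte_pmul2l ?lte_fin ?invr_gt0 ?mulr_gt0 ?pi_gt0//.
  rewrite lteD// lte_pmul2l// lte_fin powR_gt0//.
rewrite -!EFinM lee_fin /B2k /E2k.
set U1 := TricomiU _ _ (2 * pi * a^-1); set U2 := TricomiU _ _ _.
(* Every power of [a] involved is an integer power of its fourth root [b], so the remaining equality
   becomes a rational identity for [field]. *)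
set b := a `^ (1 / 4).
have b0 : 0 < b by rewrite powR_gt0.
have aE : a = b ^+ 4 by rewrite -powR_mulrn ?ltW// -powRrM [1 / 4 * _](_ : _ = 1) ?powRr1 ?ltW//; field.
have -> : a `^ (1 / 2) = b ^+ 2 by rewrite -powR_mulrn ?ltW// -powRrM; congr powR; field.
have -> : a `^ (- (3 / 4)) = (b ^+ 3)^-1.
  by rewrite powRN -powR_mulrn ?ltW// -powRrM; congr (_ `^ _)^-1; field.
have -> : a^-1 `^ (1 / 4) = b^-1.
  by rewrite -powR_inv1 ?(ltW a0)// -powRrM mulrC powRrM powR_inv1// ltW.
have s2 : Num.sqrt 2 != 0 :> R by rewrite gt_eqF// sqrtr_gt0.
rewrite le_eqVlt; apply/predU1P; left.
rewrite -/n; move: U1 U2 (Psi a) (Psi a^-1) => U1 U2 P1 P2.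
rewrite [X in (4 * pi * X)^-1]aE.
have p0 : pi != 0 :> R by rewrite gt_eqF ?pi_gt0.
move: (pi : R) p0 => p p0; by field; rewrite p0 s2 (gt_eqF b0).
Qed.
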